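(* Let $T\subseteq S$ and let $G$ be a finite group. Suppose there exists $n_0\in\mathbb{N}$ such that $\langle S_n(T)\rangle\cong G$ for every $n\ge n_0$. Then $S(T)=\mathrm{Grid}(\tilde P)$ for a finite set $\tilde P$ of peg permutations, each of which is either unlabeled, or of the form $$\tilde\rho=a_1\cdots a_r\,(r+1)^+\,b_1\cdots b_s$$ or of the form $$\tilde\rho=b_1\cdots b_s\,(r+1)^-\,a_1\cdots a_r,$$ where $a_i<r+1$ and $b_j>r+1$ for all $i,j$ (and $r+1$ is the only labeled entry). In particular, for $n$ sufficiently large, every $\pi\in S_n(T)$ is either of the form $\pi=123[\tau,\mathrm{id},\sigma]$ for some element $a_1\cdots a_r\,(r+1)^+\,b_1\cdots b_s$ of $\tilde P$, or of the form $\pi=321[\sigma,\psi,\tau]$ for some element $b_1\cdots b_s\,(r+1)^-\,a_1\cdots a_r$ of $\tilde P$, where $\tau\le a_1\cdots a_r$, $\sigma\le b_1\cdots b_s$, $\mathrm{id}$ and $\psi$ denote an increasing and a decreasing permutation respectively, and $|\tau|+|\mathrm{id}|+|\sigma|=n$.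
   Context: $S_n$ is the symmetric group on $[n]$, permutations in one-line notation, $S=\bigcup_{n\ge0}S_n$. For permutations $\tau,\pi$, write $\tau\le\pi$ if some subsequence of $\pi$ is order-isomorphic to $\tau$ (pattern containment, the empty permutation being contained in every permutation); otherwise $\pi$ avoids $\tau$. For $T\subseteq S$, $S_n(T)$ is the set of permutations in $S_n$ avoiding all patterns in $T$, $S(T)=\bigcup_n S_n(T)$, and $\langle A\rangle$ is the subgroup generated by $A$. For $\sigma\in S_m$ and (possibly empty) permutations $\alpha_1,\dots,\alpha_m$, the inflation $\sigma[\alpha_1,\dots,\alpha_m]$ is obtained by replacing the $i$-th entry of $\sigma$ by a block of contiguous entries with contiguous values order-isomorphic to $\alpha_i$, keeping the relative order of the blocks. A peg permutation $\tilde\rho$ is a permutation $\rho$ some of whose entries are labeled $+$ and some labeled $-$. Its grid class $\mathrm{Grid}(\tilde\rho)$ is the set of permutations obtained by inflating $\rho$ where each $+$ entry is inflated by a possibly empty increasing sequence, each $-$ entry by a possibly empty decreasing sequence, and each unlabeled entry by a single entry or the empty permutation; $\mathrm{Grid}(\tilde P)=\bigcup_{\tilde\rho\in\tilde P}\mathrm{Grid}(\tilde\rho)$. *)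

(* Defs.v *)
From HB Require Import structures.
From mathcomp Require Import all_boot all_fingroup.
From mathcomp Require Import boolp classical_sets.

Set Implicit Arguments.
Unset Strict Implicit.
Unset Printing Implicit Defensive.

Local Open Scope nat_scope.
Local Open Scope classical_set_scope.

Definition perms := {n : nat & 'S_n}.
Definition to_perms (n : nat) (p : 'S_n) : perms := Tagged (fun n => 'S_n) p.
Definition len (p : perms) : nat := tag p.

(* 'S_n permutes {0, ..., n-1}; one-line notation is written with the entries
   1, ..., n. *)
Definition oneline (p : perms) : seq nat :=
  [seq (nat_of_ord (tagged p i)).+1 | i <- enum 'I_(len p)].

Definition id_perm (k : nat) : 'S_k := 1%g.
Definition rev_perm (k : nat) : 'S_k := perm (@rev_ord_inj k).
Definition increasing (k : nat) : perms := to_perms (id_perm k).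
Definition decreasing (k : nat) : perms := to_perms (rev_perm k).

Definition order_iso (u v : seq nat) : Prop :=
  size u = size v /\
  forall i j, i < size u -> j < size u ->
    (nth 0 u i < nth 0 u j) = (nth 0 v i < nth 0 v j).

(* Stated for a word w, so that it applies both to w = oneline p and to the
   factors a_1 ... a_r and b_1 ... b_s of the one-line notation of a peg
   permutation. *)
Definition contained (t : perms) (w : seq nat) : Prop :=
  exists2 u : seq nat, subseq u w & order_iso u (oneline t).

Definition avoiders (T : set perms) : set perms :=
  [set p | forall t, T t -> ~ contained t (oneline p)].

Definition avoiders_n (T : set perms) (n : nat) : {set 'S_n} :=
  [set p : 'S_n | `[< avoiders T (to_perms p) >]]%SET.

(* One-line notation of s[alpha_1, ..., alpha_m]: the block replacing the entry
   s i is alpha_i, shifted above all the blocks that replace smaller entries. *)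
Definition inflate (m : nat) (s : 'S_m) (alpha : m.-tuple perms) : seq nat :=
  flatten [seq [seq x + \sum_(j < m | s j < s i) len (tnth alpha j)
               | x <- oneline (tnth alpha i)]
          | i <- enum 'I_m].

Definition is_inflation (p : perms) (m : nat) (s : 'S_m)
    (alpha : m.-tuple perms) : Prop :=
  oneline p = inflate s alpha.

(* The label of an entry (indexed by its position) is Some true for +,
   Some false for -, None for an unlabeled entry. *)
Definition peg := {n : nat & ('S_n * {ffun 'I_n -> option bool})%type}.
Definition peg_perm (r : peg) : 'S_(tag r) := (tagged r).1.
Definition peg_label (r : peg) : 'I_(tag r) -> option bool := (tagged r).2.

Definition fills (l : option bool) (p : perms) : Prop :=
  match l with
  | Some true => exists k, p = increasing k
  | Some false => exists k, p = decreasing k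
  | None => len p <= 1
  end.

Definition grid (r : peg) : set perms :=
  [set p | exists2 alpha : (tag r).-tuple perms,
             forall i, fills (peg_label i) (tnth alpha i)
             & is_inflation p (peg_perm r) alpha].

Definition grid_class (P : seq peg) : set perms :=
  \bigcup_(r in [set` P]) grid r.

Definition unlabeled (r : peg) : Prop :=
  forall i : 'I_(tag r), peg_label i = None.

(* r = a_1 ... a_r (r+1)^+ b_1 ... b_s *)
Definition plus_form (r : peg) (a b : seq nat) : Prop :=
  [/\ oneline (to_perms (peg_perm r)) = a ++ (size a).+1 :: b,
      all (fun x => x < (size a).+1) a,
      all (fun y => (size a).+1 < y) b
    & forall i : 'I_(tag r),
        peg_label i = if i == size a :> nat then Some true else None].

(* r = b_1 ... b_s (r+1)^- a_1 ... a_r *)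
Definition minus_form (r : peg) (a b : seq nat) : Prop :=
  [/\ oneline (to_perms (peg_perm r)) = b ++ (size a).+1 :: a,
      all (fun x => x < (size a).+1) a,
      all (fun y => (size a).+1 < y) b
    & forall i : 'I_(tag r),
        peg_label i = if i == size b :> nat then Some false else None].

(* Main.v *)
(* Let M = |G|.  Deleting the i-th entry of p in S_n(T) gives an element of
   S_{n-1}(T), and deletions at two different "breaks" (positions i at which
   p(i+1) is not p(i) + 1 or p(i) - 1) give different permutations.  Since
   |S_{n-1}(T)| <= M, a long p contains a long monotone block.  If the block is
   increasing, the rest of p lies below and to the left, or above and to the
   right, of it: otherwise two deletions of p would differ on the block by a
   shift by 1, and their quotient would have order larger than M.  So long
   increasing blocks consist of fixed points, and no point between two long runs
   of fixed points is moved, since deleting points of the two runs would produce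
   more than M permutations of the same size.  Hence p = 123[t, id, s] with
   |t| = |s| = (M+2)^2.  The decreasing case follows by reversing all the words,
   which does not change the quotients q^-1 q'.  Only finitely many pairs (t, s)
   occur, and for each of them the admissible lengths of the middle block are
   closed downwards, hence bounded or arbitrary. *)
Require Import Defs.
From mathcomp Require Import all_boot all_fingroup.
From mathcomp Require Import boolp classical_sets.
From mathcomp Require Import zify.

Set Implicit Arguments.
Unset Strict Implicit.
Unset Printing Implicit Defensive.

Local Open Scope nat_scope.

(** * Permutations as injections of the natural numbers *)

(* Outside [0, n) the value is x itself, so that pn p is injective on nat. *)
Definition pn (n : nat) (p : 'S_n) (x : nat) : nat :=
  if insub x is Some i then val (p i) else x.

Lemma pn_ord n (p : 'S_n) (i : 'I_n) : pn p i = p i.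
Proof. by rewrite /pn valK. Qed.

Lemma pn_ge n (p : 'S_n) x : n <= x -> pn p x = x.
Proof. by move=> le; rewrite /pn insubN // -leqNgt. Qed.

Lemma pn_lt n (p : 'S_n) x : (pn p x < n) = (x < n).
Proof.
case: (ltnP x n) => [lt|le]; last by rewrite pn_ge // ltnNge le.
by rewrite -[x]/(val (Ordinal lt)) pn_ord ltn_ord.
Qed.

Lemma pn_inj n (p : 'S_n) : injective (pn p).
Proof.
move=> x y.
case: (ltnP x n) (ltnP y n) => [ltx|lex] [lty|ley].
- rewrite -[x]/(val (Ordinal ltx)) -[y]/(val (Ordinal lty)) !pn_ord.
  by move/val_inj/perm_inj=> ->.
- move=> e; have := pn_lt p x; rewrite e pn_ge // ltx; lia.
- move=> e; have := pn_lt p y; rewrite -e pn_ge // lty; lia.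
- by rewrite !pn_ge.
Qed.

Lemma pn_ext n (p q : 'S_n) : (forall x, x < n -> pn p x = pn q x) -> p = q.
Proof.
by move=> e; apply/permP=> i; apply/val_inj; rewrite /= -!pn_ord e.
Qed.

Lemma pnM n (p q : 'S_n) x : pn (p * q)%g x = pn q (pn p x).
Proof.
case: (ltnP x n) => [lt|le]; last by rewrite !pn_ge // pn_ge.
by rewrite -[x]/(val (Ordinal lt)) !pn_ord permM.
Qed.

Lemma pn1 n x : pn (1%g : 'S_n) x = x.
Proof. by rewrite /pn; case: insubP => [i _ <-|//]; rewrite perm1. Qed.

Lemma pn_rev n x : x < n -> pn (rev_perm n) x = n - x.+1.
Proof.
by move=> lt; rewrite -[x in LHS]/(val (Ordinal lt)) pn_ord /rev_perm permE.
Qed.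

(** * Deletion of one entry *)

(** [unlift] never fails here, because [lift i x] differs from [i] and [p] is injective; the default
    [x] is a dummy. *)
Definition del_fun n (i : 'I_n.+1) (p : 'S_n.+1) (x : 'I_n) : 'I_n :=
  odflt x (unlift (p i) (p (lift i x))).

Lemma del_funE n (i : 'I_n.+1) (p : 'S_n.+1) (x : 'I_n) :
  lift (p i) (del_fun i p x) = p (lift i x).
Proof.
rewrite /del_fun; case: unliftP => [j ->//|/perm_inj/esym/eqP].
by rewrite (negbTE (neq_lift i x)).
Qed.

Lemma del_fun_inj n (i : 'I_n.+1) (p : 'S_n.+1) : injective (del_fun i p).
Proof.
move=> x y e; have := del_funE i p x.
by rewrite e del_funE => /perm_inj/lift_inj.
Qed.

Definition del n (i : 'I_n.+1) (p : 'S_n.+1) : 'S_n := perm (@del_fun_inj n i p).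

Lemma pn_del n (i : 'I_n.+1) (p : 'S_n.+1) x :
  pn (del i p) x = unbump (pn p i) (pn p (bump i x)).
Proof.
case: (ltnP x n) => [lt|le].
  rewrite -[x]/(val (Ordinal lt)) (pn_ord (del i p)) permE.
  rewrite -[bump i _]/(val (lift i (Ordinal lt))) !pn_ord -del_funE /=.
  by rewrite bumpK.
rewrite pn_ge //; have hi : pn p i < n.+1 by rewrite pn_lt ltn_ord.
have lt : n.+1 <= bump i x by move: (ltn_ord i); rewrite /bump; lia.
rewrite (pn_ge p lt); move: (ltn_ord i) lt; rewrite /unbump /bump; lia.
Qed.

(** * Classes with few members and quotients of small order, and their reversal *)

(** Keeps of the groups only what survives reversal: reversing all words may enlarge the generated
    group, but it preserves each quotient [p^-1 * q], hence the bound on its order. *)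
Definition small_class (M n0 : nat) (D : forall n, {set 'S_n}) : Prop :=
  [/\ forall n (p : 'S_n.+1) (i : 'I_n.+1), p \in D n.+1 -> del i p \in D n,
      forall n, n0 <= n -> #|D n| <= M
    & forall n (p q : 'S_n), n0 <= n -> p \in D n -> q \in D n ->
        #[p^-1 * q]%g <= M].

Definition rev_class (D : forall n, {set 'S_n}) n : {set 'S_n} :=
  [set p | (rev_perm n * p)%g \in D n].

Lemma rev_permK n (p : 'S_n) : (rev_perm n * (rev_perm n * p) = p)%g.
Proof. by apply/permP=> x; rewrite !permM /rev_perm !permE rev_ordK. Qed.

Lemma del_rev n (i : 'I_n.+1) (p : 'S_n.+1) :
  (rev_perm n * del i p)%g = del (rev_ord i) (rev_perm n.+1 * p)%g.
Proof.
apply: pn_ext => x lt; rewrite pnM !pn_del !pnM.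
have -> : pn (rev_perm n.+1) (rev_ord i) = i.
  by rewrite pn_ord /rev_perm permE rev_ordK.
have lti := ltn_ord i.
congr (unbump _ (pn _ _)); rewrite !pn_rev /=; rewrite /bump; lia.
Qed.

Lemma small_class_rev M n0 D : small_class M n0 D -> small_class M n0 (rev_class D).
Proof.
case=> H1 H2 H3; split.
- move=> n p i; rewrite !inE => h.
  by rewrite del_rev; apply: H1.
- move=> n le; rewrite -(card_imset _ (@mulgI _ (rev_perm n))).
  apply: leq_trans (H2 n le); apply: subset_leq_card.
  by apply/fintype.subsetP=> _ /imsetP[p + ->]; rewrite inE.
- move=> n p q le; rewrite !inE => hp hq.
  by have := H3 _ _ _ le hp hq; rewrite invMg mulgA -(mulgA p^-1%g) mulVg mulg1.
Qed.

(** * Long increasing blocks *)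

Section Structure.

Context (M n0 : nat) (D : forall n, {set 'S_n}) (HD : small_class M n0 D).

Lemma M_gt0 n (p : 'S_n) : n0 <= n -> p \in D n -> 0 < M.
Proof. by case: HD => _ _ H le hp; have := H _ _ _ le hp hp; rewrite mulVg order1. Qed.

(** With c = q1(a), the quotient g of [q1] and [q2] sends c + j to c + j + 1 for j < k, so its j-th
    power sends c to c + j for j <= k. Taking j to be the order of g, which is at most M <= k, gives
    c = c + j with j > 0. *)
Lemma no_shift n (q1 q2 : 'S_n) a k :
  n0 <= n -> q1 \in D n -> q2 \in D n -> a + k <= n -> M <= k ->
  (forall x, a <= x < a + k -> pn q2 x = (pn q1 x).+1) ->
  (forall x, a <= x < a + k -> pn q1 x = x - a + pn q1 a) -> False.
Proof.
move=> le h1 h2 lek leM hs hc.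
case: HD => _ _ /(_ _ _ _ le h1 h2); set g := (_ * _)%g => ord_le.
have it j : j <= k -> pn (g ^+ j)%g (pn q1 a) = pn q1 a + j.
  elim: j => [|j IH] lt; first by rewrite expg0 pn1 addn0.
  rewrite expgSr pnM IH 1?ltnW //.
  have -> : pn q1 a + j = pn q1 (a + j) by rewrite (hc (a + j)); lia.
  rewrite -pnM /g mulgA mulgV mul1g hs ?(hc (a + j)); lia.
have := it _ (leq_trans ord_le leM).
have og := order_gt0 g.
by rewrite expg_order pn1; lia.
Qed.

Lemma inc_block n (p : 'S_n.+1) a k c : n0 <= n -> p \in D n.+1 ->
  M < k -> a + k <= n.+1 ->
  (forall x, a <= x < a + k -> pn p x = x - a + c) ->
  forall y, (y < a -> pn p y < c) /\ (a + k <= y -> c + k <= pn p y).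
Proof.
move=> le hp ltk lek hc.
have M0 : 0 < M.
  by apply: (@M_gt0 n (del ord0 p)) => //; case: HD => H _ _; apply: H.
(* The values in [c, c + k) are all taken on the block already. *)
have out y : ~~ (a <= y < a + k) -> pn p y < c \/ c + k <= pn p y.
  move=> hy; case: (ltnP (pn p y) c) => [|h1]; first by left.
  case: (leqP (c + k) (pn p y)) => [|h2]; first by right.
  have e : pn p (pn p y - c + a) = pn p y by rewrite hc; lia.
  by move/pn_inj: e; lia.
(* Reference deletion: removing the last entry of the block leaves its first k - 1 entries
   unchanged. *)
have lt2 : a + k.-1 < n.+1 by lia.
have d2 : del (Ordinal lt2) p \in D n by case: HD => H _ _; apply: H.
have e2 x : a <= x < a + k.-1 -> pn (del (Ordinal lt2) p) x = x - a + c.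
  move=> hx; rewrite pn_del /= (hc (a + k.-1)); last lia.
  have -> : bump (a + k.-1) x = x by rewrite /bump; lia.
  rewrite (hc x) /unbump; lia.
move=> y; split=> hy.
  (* If y is left of the block but above it, deleting y moves the block one position to the left and
     keeps its values: at equal positions they are larger by 1 than in the reference. *)
  case: (out y) => [|//|h]; first lia.
  have lty : y < n.+1 by lia.
  have d1 : del (Ordinal lty) p \in D n by case: HD => H _ _; apply: H.
  have e1 x : a <= x < a + k.-1 -> pn (del (Ordinal lty) p) x = x.+1 - a + c.
    move=> hx; rewrite pn_del /=.
    have -> : bump y x = x.+1 by rewrite /bump; lia.
    rewrite (hc x.+1) /unbump; lia.
  exfalso; apply: (@no_shift n (del (Ordinal lt2) p) (del (Ordinal lty) p) a k.-1);
    rewrite //; try lia.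
    move=> x hx; rewrite e1 // e2 //; lia.
  move=> x hx; rewrite !e2; lia.
(* If y is right of the block but below it, deleting y lowers the values of the block by 1 and keeps
   its positions. *)
case: (out y) => [|h|//]; first lia.
case: (ltnP y n.+1) => [lty|ley]; last first.
  by move: h; rewrite pn_ge //; have := pn_lt p a; rewrite hc; lia.
have d1 : del (Ordinal lty) p \in D n by case: HD => H _ _; apply: H.
have e1 x : a <= x < a + k.-1 -> pn (del (Ordinal lty) p) x = x - a + c.-1.
  move=> hx; rewrite pn_del /=.
  have -> : bump y x = x by rewrite /bump; lia.
  rewrite (hc x) /unbump; lia.
exfalso; apply: (@no_shift n (del (Ordinal lty) p) (del (Ordinal lt2) p) a k.-1);
  rewrite //; try lia.
  move=> x hx; rewrite e1 // e2 //; lia.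
move=> x hx; rewrite !e1; lia.
Qed.

Lemma card_interval_inj (f : nat -> nat) a b :
  injective f -> (forall x, x < a -> f x < b) -> a <= b.
Proof.
move=> fi h; have : uniq (map f (iota 0 a)) by rewrite map_inj_uniq ?iota_uniq.
move/uniq_leq_size => /(_ (iota 0 b)); rewrite size_map !size_iota; apply.
by move=> _ /mapP[x + ->]; rewrite !mem_iota /=; exact: h.
Qed.

(** Counting both ways: the a positions before the block take values below c, and the c + k values
    below the top of the block are taken at positions below a + k. *)
Lemma inc_block_fixed n (p : 'S_n.+1) a k c : n0 <= n -> p \in D n.+1 ->
  M < k -> a + k <= n.+1 ->
  (forall x, a <= x < a + k -> pn p x = x - a + c) -> a = c.
Proof.
move=> le hp ltk lek hc; have hb := inc_block le hp ltk lek hc.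
apply/eqP; rewrite eqn_leq; apply/andP; split.
  by apply: (@card_interval_inj (pn p)) => [|x]; [exact: pn_inj | case: (hb x)].
rewrite leqNgt; apply/negP => lt.
have := @card_interval_inj (pn p^-1%g) (c + k) (a + k) (@pn_inj _ _).
rewrite leq_add2r leqNgt lt => /(_ _)/negP; case=> // x hx.
rewrite ltnNge; apply/negP => h.
case: (hb (pn p^-1%g x)) => _ /(_ h).
rewrite -pnM mulVg pn1; lia.
Qed.


(** * Breaks and monotone windows *)

(** The last position counts as a break, so a position outside the set always has a right
    neighbour. *)
Definition breaks n (p : 'S_n) : {set 'I_n} :=
  [set i : 'I_n | ~~ ((i.+1 < n) &&
     ((pn p i.+1 == (pn p i).+1) || (pn p i == (pn p i.+1).+1)))]%SET.

(** Compare at position i: one deletion puts p(i+1) there, the other keeps p(i). After the gaps in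
    the values are closed, they can agree only if p(i) and p(i+1) differ by 1. *)
Lemma del_inj_breaks n (p : 'S_n.+1) (i j : 'I_n.+1) :
  i \in breaks p -> i < j -> del i p <> del j p.
Proof.
rewrite inE => hb lt e; have ltn : i < n by have := ltn_ord j; lia.
have : pn (del i p) i = pn (del j p) i by rewrite e.
rewrite !pn_del.
have -> : bump i i = i.+1 by rewrite /bump; lia.
have -> : bump j i = i by rewrite /bump; lia.
have ne1 : pn p i <> pn p i.+1 by move/pn_inj; lia.
have ne2 : pn p i <> pn p j by move/pn_inj; lia.
move: hb; rewrite /unbump; lia.
Qed.

Lemma card_breaks n (p : 'S_n.+1) : n0 <= n -> p \in D n.+1 -> #|breaks p| <= M.+1.
Proof.
move=> le hp; rewrite (cardsD1 ord_max).
rewrite -[M.+1]add1n; apply: leq_add; first exact: leq_b1.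
case: HD => H1 H2 _; apply: leq_trans (H2 _ le).
rewrite -(@card_in_imset _ _ (fun i => del i p)); last first.
  move=> i j; rewrite !in_setD1 => /andP[_ bi] /andP[_ bj] e.
  apply/val_inj/eqP; case: ltngtP => //= lt.
  - by case: (del_inj_breaks bi lt e).
  - by case: (del_inj_breaks bj lt (esym e)).
by apply/subset_leq_card/fintype.subsetP=> _ /imsetP[i _ ->]; apply: H1.
Qed.

(** Pigeonhole: M + 2 disjoint windows of length K against at most M + 1 breaks. *)
Lemma break_free_window n (p : 'S_n.+1) s K : n0 <= n -> p \in D n.+1 ->
  s + M.+2 * K <= n.+1 ->
  exists a, [/\ s <= a, a + K <= s + M.+2 * K &
    forall i : 'I_n.+1, a <= i < a + K -> i \notin breaks p].
Proof.
move=> le hp les; apply: contrapT => hno.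
have ex (j : 'I_M.+2) : exists i : 'I_n.+1,
    (s + j * K <= i < s + j * K + K) && (i \in breaks p).
  apply: contrapT => hj; apply: hno; exists (s + j * K); split.
  - lia.
  - by rewrite -addnA -mulSnr leq_add2l leq_mul2r ltn_ord orbT.
  - by move=> i hi; apply/negP => hb; apply: hj; exists i; rewrite hi hb.
have [f hf] : exists f : 'I_M.+2 -> 'I_n.+1, forall j : 'I_M.+2,
    (s + j * K <= f j < s + j * K + K) && (f j \in breaks p).
  by exists (fun j => xchoose (ex j)) => j; exact: (xchooseP (ex j)).
have inj : injective f.
  move=> j j' e; have := hf j'; rewrite -e; have := hf j.
  move=> /andP[/andP[h1 h2] _] /andP[/andP[h3 h4] _].
  apply/val_inj/eqP; case: ltngtP => //= lt.
  - by have : j.+1 * K <= j' * K by [rewrite leq_mul2r lt orbT]; rewrite mulSn; lia.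
  - by have : j'.+1 * K <= j * K by [rewrite leq_mul2r lt orbT]; rewrite mulSn; lia.
have := card_breaks le hp; apply/negP; rewrite -ltnNge.
rewrite -[X in X <= _](card_ord M.+2) -cardsT -(card_imset _ inj).
apply/subset_leq_card/fintype.subsetP=> _ /imsetP[j _ ->].
by case/andP: (hf j).
Qed.

(** Each step inside the window is +1 or -1, and injectivity forbids p(x+2) = p(x), so the direction
    of the first step persists. *)
Lemma window_monotone n (p : 'S_n.+1) a K :
  (forall i : 'I_n.+1, a <= i < a + K.+2 -> i \notin breaks p) ->
  a + K.+2 <= n.+1 ->
  (forall x, a <= x < a + K.+2 -> pn p x = x - a + pn p a) \/
  (forall x, a <= x < a + K.+2 -> pn p x + (x - a) = pn p a).
Proof.
move=> hb lek.
have st x : a <= x < a + K.+2 ->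
    pn p x.+1 = (pn p x).+1 \/ pn p x = (pn p x.+1).+1.
  move=> hx; have lt : x < n.+1 by lia.
  by have := hb (Ordinal lt) hx; rewrite inE negbK /= => /andP[_ /orP[] /eqP]; auto.
have ne x : pn p x.+2 <> pn p x by move/pn_inj; lia.
case: (st a) => [|h0|h0]; first lia; [left|right].
- have up j : j < K.+2 -> pn p (a + j.+1) = (pn p (a + j)).+1.
    elim: j => [|j IH] lt; first by rewrite addn0 addn1.
    have := IH (ltnW lt); rewrite !addnS in IH *.
    have := st (a + j).+1; have := ne (a + j).
    lia.
  have al j : j < K.+2 -> pn p (a + j) = j + pn p a.
    elim: j => [|j IH] lt; first by rewrite addn0.
    by rewrite up ?IH // ltnW.
  by move=> x hx; have := al (x - a); rewrite subnKC; [apply; lia | lia].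
- have up j : j < K.+2 -> (pn p (a + j.+1)).+1 = pn p (a + j).
    elim: j => [|j IH] lt; first by rewrite addn0 addn1.
    have := IH (ltnW lt); rewrite !addnS in IH *.
    have := st (a + j).+1; have := ne (a + j).
    lia.
  have al j : j < K.+2 -> pn p (a + j) + j = pn p a.
    elim: j => [|j IH] lt; first by rewrite !addn0.
    by rewrite addnS -addSn up ?IH // ltnW.
  by move=> x hx; have := al (x - a); rewrite subnKC; [apply; lia | lia].
Qed.

(** * Two long runs of fixed points *)

(* Deleting points of the first run of fixed points or of the second one moves
   [x] to M+1 different places, while [a, x) stays fixed: this yields M+1
   different permutations of the same size. *)
Lemma del_fixed_runs m : forall n (p : 'S_n) a x z i,
  p \in D n -> i <= m -> a + m <= x -> x < z -> z + m <= n ->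
  (forall y, a <= y < x -> pn p y = y) -> pn p x <> x ->
  (forall y, z <= y < z + m -> pn p y = y) ->
  exists q : 'S_(n - m), [/\ q \in D (n - m), pn q (x - i) <> x - i &
    forall y, a <= y < x - i -> pn q y = y].
Proof.
elim: m => [|m IH] n p a x z i hp lei lea ltz lez fa mx fz.
  rewrite subn0; have -> : i = 0 by lia.
  by rewrite subn0; exists p.
case: n p hp lez fa mx fz => [|n] p hp lez fa mx fz; first lia.
(* Here i counts the deletions still to be made in the first run. Once it is 0, z is deleted and x
   stays in place; otherwise a is deleted and x, z move down by 1. *)
rewrite subSS; case: i lei => [|i] lei.
  have lt : z < n.+1 by lia.
  have pz : pn p z = z by apply: fz; lia.
  have bx y : y < z -> bump z y = y by rewrite /bump; lia.
  have by' y : z <= y -> bump z y = y.+1 by rewrite /bump; lia.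
  apply: (IH n (del (Ordinal lt) p) a x z 0) => //; try lia.
  - by case: HD => H _ _; apply: H.
  - by move=> y hy; rewrite pn_del /= pz bx ?fa /unbump; lia.
  - rewrite pn_del /= pz bx // /unbump; have : pn p x <> pn p z by move/pn_inj; lia.
    lia.
  - by move=> y hy; rewrite pn_del /= pz by' ?fz /unbump; lia.
have lt : a < n.+1 by lia.
have pa : pn p a = a by apply: fa; lia.
have by' y : a <= y -> bump a y = y.+1 by rewrite /bump; lia.
have -> : x - i.+1 = x.-1 - i by lia.
apply: (IH n (del (Ordinal lt) p) a x.-1 z.-1 i) => //; try lia.
- by case: HD => H _ _; apply: H.
- by move=> y hy; rewrite pn_del /= pa by' ?fa /unbump; lia.
- rewrite pn_del /= pa by' ?prednK; try lia.
  rewrite /unbump; have : pn p x <> pn p a by move/pn_inj; lia.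
  lia.
- by move=> y hy; rewrite pn_del /= pa by' ?fz /unbump; lia.
Qed.

Lemma no_two_fixed_runs n (p : 'S_n) a x z :
  n0 + M <= n -> p \in D n -> a + M <= x -> x < z -> z + M <= n ->
  (forall y, a <= y < x -> pn p y = y) -> pn p x <> x ->
  (forall y, z <= y < z + M -> pn p y = y) -> False.
Proof.
move=> le hp lea ltz lez fa mx fz.
have ex (i : 'I_M.+1) : exists q : 'S_(n - M), [&& q \in D (n - M),
    pn q (x - i) != x - i & [forall y : 'I_n, (a <= y < x - i) ==> (pn q y == y)]].
  have [|q [h1 h2 h3]] := @del_fixed_runs M n p a x z i hp _ lea ltz lez fa mx fz.
    by rewrite -ltnS.
  exists q; apply/and3P; split => //; first by apply/eqP.
  by apply/forallP=> y; apply/implyP=> hy; rewrite h3.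
pose f i := xchoose (ex i).
have hf i := xchooseP (ex i).
(* For i < j the point x - j is fixed by [f i] and moved by [f j]. *)
have key (i j : 'I_M.+1) : f i = f j -> i < j -> False.
  move=> e lt; case/and3P: (hf i); case/and3P: (hf j).
  rewrite -!/(f _) -e => _ /eqP hm _ _ _ /forallP h.
  have lt' : x - j < n by lia.
  have := h (Ordinal lt'); move: (ltn_ord j) => ltj.
  have -> /= : (a <= Ordinal lt' < x - i) by rewrite /=; lia.
  by move/eqP.
have inj : injective f.
  move=> i j e; apply/val_inj/eqP; case: ltngtP => //= lt.
  - by case: (key _ _ e lt).
  - by case: (key _ _ (esym e) lt).
case: HD => _ H2 _; have : n0 <= n - M by lia.
move/H2; apply/negP; rewrite -ltnNge.
rewrite -[X in X <= _](card_ord M.+1) -cardsT -(card_imset _ inj).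
apply/subset_leq_card/fintype.subsetP=> _ /imsetP[j _ ->].
by case/and3P: (hf j).
Qed.

End Structure.

(** * The shape of long permutations in the class *)

Lemma dec_block M n0 D n (p : 'S_n.+1) a k c : small_class M n0 D ->
  n0 <= n -> p \in D n.+1 -> M < k -> a + k <= n.+1 ->
  (forall x, a <= x < a + k -> pn p x + (x - a) = c + k.-1) ->
  forall y, y < n.+1 ->
    (y < a -> c + k <= pn p y) /\ (a + k <= y -> pn p y < c).
Proof.
move=> HD le hp ltk lek hc y lty.
have hp' : (rev_perm n.+1 * p)%g \in rev_class D n.+1 by rewrite inE rev_permK.
have e x : x < n.+1 -> pn (rev_perm n.+1 * p)%g x = pn p (n - x).
  by move=> lt; rewrite pnM pn_rev.
(* Reversal carries the block to positions starting at n + 1 - (a + k), where it increases from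
   c. *)
have := @inc_block _ _ _ (small_class_rev HD) _ _ (n.+1 - (a + k)) k c le hp' ltk.
move=> /(_ _ _ (n - y)) []; first lia.
  move=> x hx; rewrite e; last lia.
  have := hc (n - x); lia.
rewrite e ?subKn; lia.
Qed.

(* Each end of a long permutation is cut off at a length that leaves room for
   M+2 disjoint windows of length M+2, one of which contains no break. *)
Definition ends (M : nat) := M.+2 * M.+2.

Lemma fixed_middle M n0 D n (p : 'S_n.+1) a c : small_class M n0 D ->
  n0 + M <= n -> 2 * ends M + M.+1 <= n -> p \in D n.+1 ->
  a + M.+2 <= n.+1 ->
  (forall x, a <= x < a + M.+2 -> pn p x = x - a + c) ->
  forall x,
    [/\ ends M <= x < n.+1 - ends M -> pn p x = x, x < ends M -> pn p x < ends M
      & n.+1 - ends M <= x -> n.+1 - ends M <= pn p x].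
Proof.
move=> HD le leN hp lea inca; have le0 : n0 <= n by lia.
have ac := inc_block_fixed HD le0 hp (leqnSn _) lea inca.
have hb := inc_block HD le0 hp (leqnSn _) lea inca.
(* Every break-free window is increasing, hence fixed: a decreasing one would have everything to its
   left above it and everything to its right below it, against the position of the given increasing
   window. *)
have fixw b : (forall i : 'I_n.+1, b <= i < b + M.+2 -> i \notin breaks p) ->
    b + M.+2 <= n.+1 -> forall x, b <= x < b + M.+2 -> pn p x = x.
  move=> nb leb; have [h|h] := window_monotone nb leb.
    have e := inc_block_fixed HD le0 hp (leqnSn _) leb h.
    by move=> x hx; rewrite h // -e; lia.
  exfalso; have hl := h (b + M.+1); have h0 := h b.
  (* [pn p b - M.+1] is the smallest value of the window, taken at its last position. *)
  have hd := @dec_block _ _ _ _ _ b M.+2 (pn p b - M.+1) HD le0 hp (leqnSn _) leb.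
  have {}hd : forall y, y < n.+1 -> (y < b -> pn p b - M.+1 + M.+2 <= pn p y) /\
    (b + M.+2 <= y -> pn p y < pn p b - M.+1).
    by apply: hd => x hx; have := h x hx; lia.
  case: (ltngtP a b) => ab.
  - have := hb (b + M.+1); have := hd a; have := inca a; lia.
  - have := hb b; have := hd (a + M.+1); have := inca (a + M.+1); lia.
  - have := h a.+1; have := inca a.+1; have := inca a; rewrite -ab; lia.
have endsE : ends M = M.+2 * M.+2 by [].
have [w1 [_ l1 b1]] : exists b, [/\ 0 <= b, b + M.+2 <= 0 + M.+2 * M.+2 &
    forall i : 'I_n.+1, b <= i < b + M.+2 -> i \notin breaks p].
  by apply: (break_free_window HD) => //; lia.
have [w2 [g2 l2 b2]] : exists b, [/\ n.+1 - ends M <= b,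
    b + M.+2 <= n.+1 - ends M + M.+2 * M.+2 &
    forall i : 'I_n.+1, b <= i < b + M.+2 -> i \notin breaks p].
  by apply: (break_free_window HD) => //; lia.
have f1 := fixw _ b1; have f2 := fixw _ b2.
have mid x : ends M <= x < n.+1 - ends M -> pn p x = x.
  move=> hx; apply: contrapT => mx.
  (* Take the least moved point y >= [w1]. It is preceded by fixed points back to [w1] and followed
     by the fixed window at [w2], so there are two long fixed runs around it. *)
  have exm : exists y, (w1 <= y) && (pn p y != y).
    by exists x; apply/andP; split; [lia | apply/eqP].
  case: (ex_minnP exm) => y /andP[ly /eqP my] miny.
  have lyx : y <= x by apply: miny; apply/andP; split; [lia | apply/eqP].
  have fy u : w1 <= u < y -> pn p u = u.
    move=> hu; apply/eqP; apply: contraT => mu.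
    by have := miny u; rewrite mu; lia.
  have wy : w1 + M.+2 <= y by rewrite leqNgt; apply/negP=> lt; apply: my; apply: f1; lia.
  apply: (@no_two_fixed_runs _ _ _ HD n.+1 p w1 y w2) => //; try lia.
  by move=> u hu; apply: f2; lia.
(* The fixed middle is itself an increasing block longer than M, which keeps the two ends apart. *)
have hm := @inc_block _ _ _ HD n p (ends M) (n.+1 - 2 * ends M) (ends M) le0 hp.
have {}hm : forall y, (y < ends M -> pn p y < ends M) /\
    (ends M + (n.+1 - 2 * ends M) <= y -> ends M + (n.+1 - 2 * ends M) <= pn p y).
  by apply: hm => [||x hx]; [lia|lia|rewrite mid; lia].
by move=> x; have [h1 h2] := hm x; split; [exact: mid|exact: h1|lia].
Qed.

Lemma fixed_or_reversed_middle M n0 D n (p : 'S_n.+1) : small_class M n0 D ->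
  n0 + M <= n -> 2 * ends M + M.+1 <= n -> p \in D n.+1 ->
  exists q : 'S_n.+1, [/\ q = p \/ q = (rev_perm n.+1 * p)%g &
  forall x,
    [/\ ends M <= x < n.+1 - ends M -> pn q x = x, x < ends M -> pn q x < ends M
      & n.+1 - ends M <= x -> n.+1 - ends M <= pn q x]].
Proof.
move=> HD le leN hp; have le0 : n0 <= n by lia.
have endsE : ends M = M.+2 * M.+2 by [].
have [a [_ la ba]] : exists b, [/\ 0 <= b, b + M.+2 <= 0 + M.+2 * M.+2 &
    forall i : 'I_n.+1, b <= i < b + M.+2 -> i \notin breaks p].
  by apply: (break_free_window HD) => //; lia.
have lea : a + M.+2 <= n.+1 by lia.
have [h|h] := window_monotone ba lea.
  by exists p; split; [left | exact: (fixed_middle HD le leN hp lea h)].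
exists (rev_perm n.+1 * p)%g; split; first by right.
apply: (@fixed_middle _ _ _ _ _ (n.+1 - (a + M.+2)) (pn p a - M.+1)
          (small_class_rev HD) le leN); [by rewrite inE rev_permK | lia |].
move=> x hx; rewrite pnM pn_rev; last lia.
have := h (n.+1 - x.+1); have := h (a + M.+1); lia.
Qed.

(** * One-line notation *)

Lemma oneline_pn n (p : 'S_n) :
  oneline (to_perms p) = [seq (pn p x).+1 | x <- iota 0 n].
Proof.
rewrite /oneline /to_perms /len /= -val_enum_ord -map_comp.
by apply: eq_map => i /=; rewrite pn_ord.
Qed.

Lemma size_oneline p : size (oneline p) = len p.
Proof. by rewrite size_map size_enum_ord. Qed.

Lemma oneline_bounds p x : x \in oneline p -> 0 < x <= len p.
Proof. by case/mapP=> i _ ->; rewrite /= ltn_ord. Qed.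

Lemma oneline_increasing k : oneline (increasing k) = iota 1 k.
Proof.
rewrite /increasing oneline_pn (iotaDl 1 0); apply: eq_map => x.
by rewrite /id_perm pn1.
Qed.

Lemma map_rev_iota (f : nat -> nat) n :
  [seq f (n - x.+1) | x <- iota 0 n] = rev [seq f x | x <- iota 0 n].
Proof.
apply: (@eq_from_nth _ 0); rewrite ?size_rev !size_map ?size_iota // => i lt.
rewrite nth_rev ?size_map ?size_iota // !(nth_map 0) ?size_iota; try lia.
rewrite !nth_iota; try lia.
by rewrite !add0n.
Qed.

Lemma oneline_rev n (p : 'S_n) :
  oneline (to_perms (rev_perm n * p)%g) = rev (oneline (to_perms p)).
Proof.
rewrite !oneline_pn -(map_rev_iota (fun x => (pn p x).+1)); apply/eq_in_map => x.
by rewrite mem_iota => lt; rewrite pnM pn_rev.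
Qed.

Lemma oneline_decreasing k : oneline (decreasing k) = rev (iota 1 k).
Proof.
by rewrite -oneline_increasing -oneline_rev /id_perm mulg1.
Qed.

Lemma perm_of_fun n (f : nat -> nat) :
  (forall x, x < n -> f x < n) ->
  (forall x y, x < n -> y < n -> f x = f y -> x = y) ->
  exists p : 'S_n, forall x, x < n -> pn p x = f x.
Proof.
move=> hf fi.
have inj : injective (fun i : 'I_n => Ordinal (hf i (ltn_ord i))).
  by move=> i j [] /fi e; apply/val_inj/e.
exists (perm inj) => x lt.
by rewrite -[x in LHS]/(val (Ordinal lt)) pn_ord permE.
Qed.

Lemma perm_of_word n (w : seq nat) : size w = n -> uniq w ->
  {in w, forall x, 0 < x <= n} -> exists p : 'S_n, oneline (to_perms p) = w.
Proof.
move=> sw uw hw.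
have hn x : x < n -> 0 < nth 0 w x <= n by move=> lt; apply/hw/mem_nth; rewrite sw.
have [||p hp] := @perm_of_fun n (fun x => (nth 0 w x).-1).
- by move=> x /hn; lia.
- move=> x y lx ly /= e; apply/eqP.
  rewrite -(nth_uniq 0 (s := w)) ?sw //; apply/eqP.
  case/andP: (hn x lx) (hn y ly) => hx _ /andP[hy _].
  by rewrite -(prednK hx) -(prednK hy) e.
exists p; rewrite oneline_pn; apply: (@eq_from_nth _ 0).
  by rewrite size_map size_iota.
rewrite size_map size_iota => i lt.
by rewrite (nth_map 0) ?size_iota // nth_iota // add0n hp // prednK; case/andP: (hn i lt).
Qed.

(** * Order isomorphism and containment of words *)

(** Pairs of the zip replace positions, which masks and concatenations would renumber. *)
Lemma order_isoP u v : order_iso u v <-> size u = size v /\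
  {in zip u v &, forall a b, (a.1 < b.1) = (a.2 < b.2)}.
Proof.
split=> [[e h]|[e h]]; split=> //.
  move=> a b /(nthP (0, 0))[i + <-] /(nthP (0, 0))[j + <-].
  rewrite size_zip -e minnn => li lj; rewrite !nth_zip //=; exact: h.
move=> i j li lj.
have mz k : k < size u -> (nth 0 u k, nth 0 v k) \in zip u v.
  by move=> lt; rewrite -nth_zip // mem_nth // size_zip -e minnn.
exact: (h _ _ (mz i li) (mz j lj)).
Qed.

Lemma mask_zip (S T : Type) m (u : seq S) (v : seq T) :
  mask m (zip u v) = zip (mask m u) (mask m v).
Proof.
elim: m u v => [|b m IH] [|x u] [|y v] //=; rewrite ?mask0 ?zip_nil.
- by case: (if b then _ else _).
- by case: (if b then _ else _).
- by case: b => /=; rewrite IH.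
Qed.

Lemma order_iso_mask m u v : order_iso u v -> order_iso (mask m u) (mask m v).
Proof.
case/order_isoP=> e h; apply/order_isoP; split.
  elim: m u v e {h} => [|b m IH] [|x u] [|y v] //= [] /IH; case: b => //= ->//.
by rewrite -mask_zip => a b /mem_mask ha /mem_mask hb; apply: h.
Qed.

Lemma order_iso_trans u v w : order_iso u v -> order_iso v w -> order_iso u w.
Proof.
move=> [e1 h1] [e2 h2]; split; first by rewrite e1.
by move=> i j li lj; rewrite h1 // h2 -?e1.
Qed.

Lemma order_iso_map (f : nat -> nat) u :
  {in u &, forall x y, (f x < f y) = (x < y)} -> order_iso (map f u) u.
Proof.
move=> h; split; rewrite ?size_map // => i j li lj.
by rewrite !(nth_map 0) // h ?mem_nth.
Qed.

(** [contained t w] is by definition [embeds (oneline t) w]; with words on both sides the relation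
    can be composed. *)
Definition embeds (v w : seq nat) : Prop :=
  exists2 u, subseq u w & order_iso u v.

Lemma embeds_refl w : embeds w w.
Proof. by exists w. Qed.

Lemma embeds_trans u v w : embeds u v -> embeds v w -> embeds u w.
Proof.
move=> [x /subseqP[m sm ->] xu] [y yw yv].
exists (mask m y); first by apply: subseq_trans yw; apply: mask_subseq.
by apply: order_iso_trans xu; apply: order_iso_mask.
Qed.

Definition avoids (T : set perms) (w : seq nat) : Prop :=
  forall t, T t -> ~ contained t w.

Lemma avoids_embeds T v w : embeds v w -> avoids T w -> avoids T v.
Proof. by move=> vw h t /h ht /embeds_trans/(_ vw). Qed.

(** [bump i] skips position i, and closing the gap at [pn p i] preserves the order of the remaining
    values because none of them equals it. *)
Lemma del_embeds n (p : 'S_n.+1) i :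
  embeds (oneline (to_perms (del i p))) (oneline (to_perms p)).
Proof.
exists [seq (pn p (bump i x)).+1 | x <- iota 0 n].
  rewrite oneline_pn (map_comp (fun x => (pn p x).+1) (bump i)); apply: map_subseq.
  move: (nat_of_ord i) (ltn_ord i) => j ltj.
  have -> : n = j + (n - j) by lia.
  rewrite -[(_ + _).+1]addnS !iotaD map_cat !add0n /=; apply: cat_subseq.
    rewrite (iffLR (eq_in_map _ id _)) ?map_id // => x.
    by rewrite mem_iota /bump; lia.
  rewrite (iffLR (eq_in_map _ S _)) => [|x]; last by rewrite mem_iota /bump; lia.
  rewrite -(iotaDl 1); exact: subseq_cons.
rewrite oneline_pn; split; rewrite ?size_map // size_iota => x y lx ly.
rewrite !(nth_map 0) ?size_iota // !nth_iota // !add0n !pn_del.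
have ne z : pn p (bump i z) <> pn p i.
  by move/pn_inj/eqP; rewrite eq_sym (negbTE (neq_bump _ _)).
have := ne x; have := ne y; rewrite /unbump; lia.
Qed.

Lemma mem_zip (S T : eqType) (u : seq S) (v : seq T) a :
  a \in zip u v -> a.1 \in u /\ a.2 \in v.
Proof.
elim: u v => [|x u IH] [|y v] //=; rewrite !inE => /orP[/eqP->|/IH[h1 h2]] /=.
  by rewrite !eqxx.
by rewrite h1 h2 !orbT.
Qed.

(** * Inflations *)

Lemma zip_flatten (I : Type) (S T : Type) (f : I -> seq S) (g : I -> seq T) (s : seq I) :
  (forall i, size (f i) = size (g i)) ->
  zip (flatten (map f s)) (flatten (map g s)) =
  flatten [seq zip (f i) (g i) | i <- s].
Proof. by move=> h; elim: s => //= i s IH; rewrite zip_cat ?IH. Qed.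

Lemma subseq_flatten (I : Type) (S : eqType) (f g : I -> seq S) (s : seq I) :
  (forall i, subseq (f i) (g i)) ->
  subseq (flatten (map f s)) (flatten (map g s)).
Proof. by move=> h; elim: s => //= i s IH; apply: cat_subseq. Qed.

(** Entries of different blocks compare as the entries of [s] do, whatever the block lengths;
    entries of one block compare as in the chosen copy of the smaller block. *)
Lemma inflate_embeds m (s : 'S_m) (alpha beta : m.-tuple perms) :
  (forall i, contained (tnth alpha i) (oneline (tnth beta i))) ->
  embeds (inflate s alpha) (inflate s beta).
Proof.
move=> h.
pose sh (g : m.-tuple perms) (i : 'I_m) := \sum_(j < m | s j < s i) len (tnth g j).
(* Blocks are stacked in the order of [s]: the top of block i does not exceed the shift of block
   j. *)
have shS (g : m.-tuple perms) i j : s i < s j ->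
    len (tnth g i) + sh g i <= sh g j.
  move=> lt; rewrite /sh [X in _ <= X](bigD1 i) //= leq_add2l.
  rewrite [X in X <= _]big_mkcond [X in _ <= X]big_mkcond /=.
  apply: leq_sum => k _; case: ifP => // lk; case: ifP => //.
  by rewrite (ltn_trans lk lt) /=; case: eqP lk => [->|]; rewrite ?ltnn.
have ex i : exists v, subseq v (oneline (tnth beta i)) /\
    order_iso v (oneline (tnth alpha i)).
  by case: (h i) => v h1 h2; exists v.
have [u hu] := choice ex.
exists (flatten [seq [seq x + sh beta i | x <- u i] | i <- enum 'I_m]).
  by apply: subseq_flatten => i; apply: map_subseq; case: (hu i).
have sz i : size [seq x + sh beta i | x <- u i] =
    size [seq x + sh alpha i | x <- oneline (tnth alpha i)].
  by rewrite 2!size_map; exact: (proj1 (proj2 (hu i))).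
apply/order_isoP; split.
  rewrite /inflate !size_flatten /shape -!map_comp; congr sumn.
  by apply: eq_map => i /=; rewrite (sz i).
rewrite /inflate zip_flatten //.
have zm (f g : nat -> nat) (v w : seq nat) :
    zip (map f v) (map g w) = [seq (f a.1, g a.2) | a <- zip v w].
  by elim: v w => [|x v IH] [|y w] //=; rewrite IH.
move=> ? ? /flatten_mapP[i _] + /flatten_mapP[j _]; rewrite !zm.
move=> /mapP[a ha ->] /mapP[b hb ->] /=.
have := mem_zip ha; have := mem_zip hb.
move=> [hb1 /oneline_bounds hb2] [ha1 /oneline_bounds ha2].
have {}hb1 := oneline_bounds (mem_subseq (proj1 (hu j)) hb1).
have {}ha1 := oneline_bounds (mem_subseq (proj1 (hu i)) ha1).
(* Both comparisons are true in [lt_sh] and both are false in [gt_sh]. *)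
have lt_sh (x1 x2 y1 y2 l1 l2 z1 z2 w1 w2 : nat) : 0 < y1 -> 0 < y2 ->
    x1 <= l1 -> x2 <= l2 -> l1 + z1 <= w1 -> l2 + z2 <= w2 ->
    (x1 + z1 < y1 + w1) = (x2 + z2 < y2 + w2) by lia.
have gt_sh (x1 x2 y1 y2 l1 l2 z1 z2 w1 w2 : nat) : 0 < y1 -> 0 < y2 ->
    x1 <= l1 -> x2 <= l2 -> l1 + z1 <= w1 -> l2 + z2 <= w2 ->
    (y1 + w1 < x1 + z1) = (y2 + w2 < x2 + z2) by lia.
case/andP: ha1 ha2 hb1 hb2 => pa1 la1 /andP[pa2 la2] /andP[pb1 lb1] /andP[pb2 lb2].
case: (ltngtP (s i) (s j)) => [lt|lt|/val_inj/perm_inj e].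
- exact: lt_sh pb1 pb2 la1 la2 (shS beta _ _ lt) (shS alpha _ _ lt).
- exact: gt_sh pa1 pa2 lb1 lb2 (shS beta _ _ lt) (shS alpha _ _ lt).
- move: hb; rewrite -e !ltn_add2r => hb.
  by have [_ /order_isoP[_]] := hu i; apply.
Qed.

Lemma sum_lt_perm m (s : 'S_m) v : v <= m -> \sum_(j < m | s j < v) 1 = v.
Proof.
move=> le; rewrite (reindex_inj (@perm_inj _ s^-1%g)) /=.
under eq_bigl do rewrite permKV.
rewrite -[RHS]card_ord -sum1_card (big_ord_widen_cond m xpredT (fun=> 1)) //.
Qed.

(** The big block has k entries more than a single one, so exactly the entries above c + 1 are
    raised, by k. *)
Lemma inflate_one_block m (s : 'S_m) (alpha : m.-tuple perms) (i0 : 'I_m) k :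
  (forall i, i != i0 -> tnth alpha i = increasing 1) ->
  len (tnth alpha i0) = k.+1 ->
  forall a c b, oneline (to_perms s) = a ++ c.+1 :: b -> size a = i0 ->
  inflate s alpha =
    [seq x + (c.+1 < x) * k | x <- a] ++
    [seq x + c | x <- oneline (tnth alpha i0)] ++
    [seq x + (c.+1 < x) * k | x <- b].
Proof.
move=> h1 hk a c b es sa.
have sh i : \sum_(j < m | s j < s i) len (tnth alpha j) = s i + (s i0 < s i) * k.
  have e j : len (tnth alpha j) = 1 + (j == i0) * k.
    by case: eqVneq => [->|/h1->] //; rewrite hk mul1n.
  under eq_bigr do rewrite e.
  rewrite big_split /= sum_lt_perm ?(ltnW (ltn_ord _)) //; congr (_ + _).
  rewrite -big_distrl /=; congr (_ * k).
  rewrite big_mkcond (bigD1 i0) //= eqxx big1 ?addn0; first by case: ifP.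
  by move=> j /negbTE->; case: ifP.
pose f i := (s i).+1 + (s i0 < s i) * k.
(* Splitting the positions at [i0] matches the two remaining parts with [a] and [b]. *)
have en : enum 'I_m = take i0 (enum 'I_m) ++ i0 :: drop i0.+1 (enum 'I_m).
  rewrite -{1}(cat_take_drop i0 (enum 'I_m)); congr (_ ++ _).
  by rewrite (drop_nth i0) ?size_enum_ord // nth_ord_enum.
have := enum_uniq 'I_m; rewrite en cat_uniq /= negb_or.
move=> /and3P[_ /andP[n1 _] /andP[n2 _]].
move: es; rewrite /oneline /to_perms /len /= {1}en map_cat /= => /eqP.
rewrite eqseq_cat; last by rewrite size_map size_takel ?sa // size_enum_ord ltnW.
rewrite eqseq_cons => /and3P[/eqP ea /eqP[ec] /eqP eb].
rewrite /inflate en map_cat flatten_cat /= sh ltnn addn0 ec.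
have single (l : seq 'I_m) : i0 \notin l ->
    flatten [seq [seq x + \sum_(j < m | s j < s i) len (tnth alpha j)
                 | x <- oneline (tnth alpha i)] | i <- l] =
    [seq x + (c.+1 < x) * k | x <- [seq (s i).+1 | i <- l]].
  elim: l => //= i l IH; rewrite inE negb_or => /andP[ni /IH ->].
  rewrite sh h1; last by rewrite eq_sym.
  rewrite oneline_increasing /= ec.
  by rewrite ltnS addnA add1n.
by rewrite -ea -eb !single.
Qed.

Lemma inflate_singles m (s : 'S_m) (alpha : m.-tuple perms) :
  (forall i, tnth alpha i = increasing 1) -> inflate s alpha = oneline (to_perms s).
Proof.
move=> h1; rewrite /inflate [RHS]/oneline /=.
elim: (enum 'I_m) => //= i l ->; rewrite h1 oneline_increasing /= add1n.
by under eq_bigr do rewrite h1; rewrite sum_lt_perm // ltnW.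
Qed.

(** * Pegs with one labeled entry and the words they produce *)

Definition monotone (e : bool) (k : nat) : perms :=
  if e then increasing k else decreasing k.

(* The one-line notation of 123[t, id_k, s], resp. of 321[s, psi_k, t]. *)
Definition sum_word (e : bool) (A : nat) (t s : 'S_A) (k : nat) : seq nat :=
  let l := oneline (to_perms t) in
  let m := [seq x + A | x <- oneline (monotone e k)] in
  let r := [seq x + (A + k) | x <- oneline (to_perms s)] in
  if e then l ++ m ++ r else r ++ m ++ l.

Lemma len_monotone e k : len (monotone e k) = k.
Proof. by case: e. Qed.

(** The equality is boolean so that [xchoose] can extract the permutation in [block_peg]. *)
Lemma sum_word_perm e A (t s : 'S_A) k :
  exists p : 'S_(A + k + A), oneline (to_perms p) == sum_word e t s k.
Proof.
have szm (f : nat -> nat) p : size [seq f x | x <- oneline p] = len p.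
  by rewrite size_map size_oneline.
have un p : uniq (oneline p).
  by rewrite map_inj_uniq ?enum_uniq // => i j [] /val_inj/perm_inj.
have bt := @oneline_bounds (to_perms t); have bs := @oneline_bounds (to_perms s).
have bm := @oneline_bounds (monotone e k); rewrite len_monotone in bm.
pose w := oneline (to_perms t) ++ [seq x + A | x <- oneline (monotone e k)] ++
   [seq x + (A + k) | x <- oneline (to_perms s)].
have pw : perm_eq (sum_word e t s k) w.
  rewrite /sum_word /w; case: (e) => //.
  by apply/seq.permP=> q; rewrite !count_cat; lia.
have [|||q eq] := @perm_of_word (A + k + A) (sum_word e t s k);
  last by exists q; rewrite eq.
- by rewrite (perm_size pw) /w !size_cat !szm size_oneline len_monotone addnA.
- rewrite (perm_uniq pw) /w !cat_uniq has_cat negb_or.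
  rewrite un !(map_inj_uniq (@addIn _)) !un /= !andbT -andbA.
  apply/and3P; split; apply/hasPn=> _ /mapP[x + ->].
  + by move/bm=> hx; apply/negP => /bt; rewrite /len /=; lia.
  + by move/bs=> hx; apply/negP => /bt; rewrite /len /=; lia.
  + move/bs=> hx; apply/negP => /mapP[y /bm hy]; rewrite /len /=; lia.
- move=> x; rewrite (perm_mem pw) /w !mem_cat => /or3P[/bt|/mapP[y /bm + ->]|/mapP[y /bs + ->]];
  rewrite /len /=; lia.
Qed.

Lemma monotoneS e k : contained (monotone e k) (oneline (monotone e k.+1)).
Proof.
exists (oneline (monotone e k)) => //; case: e => /=.
  rewrite !oneline_increasing -[k.+1]addn1 iotaD; exact: prefix_subseq.
rewrite !oneline_decreasing -[k.+1]addn1 iotaD rev_cat; exact: suffix_subseq.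
Qed.

Lemma len_le1 p : len p <= 1 -> contained p (oneline (increasing 1)).
Proof.
rewrite oneline_increasing /contained => lp.
have := size_oneline p; have := @oneline_bounds p.
case: (oneline p) => [|x [|y l]] /= hb sp; last lia.
  by exists [::].
have -> : x = 1 by have := hb x (mem_head _ _); lia.
by exists [:: 1].
Qed.

(* The label sits at index A of the peg for both signs since t and s have the
   same length A. *)
Definition block_peg (e : bool) (A : nat) (t s : 'S_A) : peg :=
  existT _ (A + 1 + A)
    (xchoose (sum_word_perm e t s 1),
     [ffun i : 'I_(A + 1 + A) => if i == A :> nat then Some e else None]).

Lemma oneline_block_peg e A (t s : 'S_A) :
  oneline (to_perms (peg_perm (block_peg e t s))) = sum_word e t s 1.
Proof. exact/eqP/(xchooseP (sum_word_perm e t s 1)). Qed.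

Lemma sum_word1 e A (t s : 'S_A) :
  sum_word e t s 1 =
    let l := oneline (to_perms t) in
    let r := [seq x + A.+1 | x <- oneline (to_perms s)] in
    if e then l ++ A.+1 :: r else r ++ A.+1 :: l.
Proof.
rewrite /sum_word addn1; case: e => /=.
  by rewrite oneline_increasing /= add1n.
by rewrite oneline_decreasing /= add1n.
Qed.

Definition block_filling (e : bool) (A k : nat) : (A + 1 + A).-tuple perms :=
  [tuple if i == A :> nat then monotone e k else increasing 1 | i < A + 1 + A].

Lemma inflate_block_peg e A (t s : 'S_A) k :
  inflate (peg_perm (block_peg e t s)) (block_filling e A k.+1) =
  sum_word e t s k.+1.
Proof.
have ltA : A < A + 1 + A by lia.
have hw := oneline_block_peg e t s; rewrite sum_word1 /= in hw.
have bt := @oneline_bounds (to_perms t).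
have fixt : [seq x + (A.+1 < x) * k | x <- oneline (to_perms t)] = oneline (to_perms t).
  rewrite -[RHS]map_id; apply/eq_in_map => x /bt; rewrite /len /= => hx.
  by have -> : (A.+1 < x) = false by [lia]; rewrite addn0.
have shs : [seq x + (A.+1 < x) * k | x <- [seq x + A.+1 | x <- oneline (to_perms s)]] =
    [seq x + (A + k.+1) | x <- oneline (to_perms s)].
  rewrite -map_comp; apply/eq_in_map => x /oneline_bounds /andP[hx _] /=.
  by have -> : A.+1 < x + A.+1 by [lia]; lia.
have one i : i != Ordinal ltA -> tnth (block_filling e A k.+1) i = increasing 1.
  by rewrite tnth_mktuple -val_eqE /= => /negbTE ->.
have mid : tnth (block_filling e A k.+1) (Ordinal ltA) = monotone e k.+1.
  by rewrite tnth_mktuple eqxx.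
have lmid : len (tnth (block_filling e A k.+1) (Ordinal ltA)) = k.+1.
  by rewrite mid len_monotone.
rewrite /sum_word; case: e hw one mid lmid => hw one mid lmid.
  rewrite (inflate_one_block one lmid hw) ?size_oneline //.
  by rewrite mid fixt shs.
rewrite (inflate_one_block one lmid hw); last by rewrite size_map size_oneline.
by rewrite mid fixt shs.
Qed.

(** Filling the empty unlabeled places and lengthening the monotone block turns any member of the
    grid class into some [sum_word e t s k.+1], which therefore contains it. *)
Lemma grid_block_peg T e A (t s : 'S_A) :
  (forall k, avoids T (sum_word e t s k.+1)) ->
  forall p, grid (block_peg e t s) p -> avoiders T p.
Proof.
move=> hav p [alpha fl ep]; rewrite /is_inflation in ep.
(* k is the length of the monotone block; passing to k + 1 covers an empty block as well. *)
have [k hk] : exists k, forall i : 'I_(A + 1 + A), i == A :> nat ->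
    contained (tnth alpha i) (oneline (monotone e k.+1)).
  have ltA : A < A + 1 + A by lia.
  have := fl (Ordinal ltA); rewrite /peg_label /= ffunE eqxx => h.
  have [k ek] : exists k, tnth alpha (Ordinal ltA) = monotone e k by case: (e) h.
  exists k => i /eqP hi; have -> : i = Ordinal ltA by apply: val_inj.
  by rewrite ek; apply: monotoneS.
suff : avoids T (oneline p) by [].
rewrite ep; apply: avoids_embeds (hav k); rewrite -inflate_block_peg.
apply: inflate_embeds => i; rewrite tnth_mktuple.
case: ifP => [/hk//|hi]; apply: len_le1.
by have := fl i; rewrite /peg_label /= ffunE hi.
Qed.

Lemma block_peg_plus A (t s : 'S_A) :
  plus_form (block_peg true t s) (oneline (to_perms t))
    [seq x + A.+1 | x <- oneline (to_perms s)].
Proof.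
split; rewrite ?size_oneline.
- by rewrite oneline_block_peg sum_word1.
- by apply/allP=> x /oneline_bounds; rewrite /len /=; lia.
- by apply/allP=> _ /mapP[x /oneline_bounds + ->]; rewrite /len /=; lia.
- by move=> i; rewrite /peg_label ffunE.
Qed.

Lemma block_peg_minus A (t s : 'S_A) :
  minus_form (block_peg false t s) (oneline (to_perms t))
    [seq x + A.+1 | x <- oneline (to_perms s)].
Proof.
have sr : size [seq x + A.+1 | x <- oneline (to_perms s)] = A.
  by rewrite size_map size_oneline.
split; rewrite ?sr ?size_oneline.
- by rewrite oneline_block_peg sum_word1.
- by apply/allP=> x /oneline_bounds; rewrite /len /=; lia.
- by apply/allP=> _ /mapP[x /oneline_bounds + ->]; rewrite /len /=; lia.
- by move=> i; rewrite /peg_label ffunE.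
Qed.

Lemma contained_shift (p : perms) c : contained p [seq x + c | x <- oneline p].
Proof.
exists [seq x + c | x <- oneline p] => //.
by apply: order_iso_map => x y _ _; rewrite ltn_add2r.
Qed.

(** * Inflations of 123 and 321 *)

Lemma inflate3 (s : 'S_3) (a b c : perms) :
  let i0 := ord0 : 'I_3 in let i1 := lift ord0 ord0 : 'I_3 in
  let i2 := lift ord0 (lift ord0 ord0) : 'I_3 in
  let sh i := (s i0 < s i) * len a + (s i1 < s i) * len b + (s i2 < s i) * len c in
  inflate s [tuple a; b; c] =
  [seq x + sh i0 | x <- oneline a] ++ [seq x + sh i1 | x <- oneline b] ++
  [seq x + sh i2 | x <- oneline c].
Proof.
move=> i0 i1 i2 sh.
have e i : \sum_(j < 3 | s j < s i) len (tnth [tuple a; b; c] j) = sh i.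
  rewrite big_mkcond !big_ord_recl big_ord0 /sh /= addn0 addnA.
  by congr (_ + _ + _); case: ifP => _; rewrite ?mul1n ?mul0n.
rewrite /inflate; under eq_map => i do rewrite e.
have -> : enum 'I_3 = [:: i0; i1; i2].
  by apply: (inj_map val_inj); rewrite val_enum_ord.
by rewrite /= cats0.
Qed.

Lemma inflate_id3 (a b c : perms) :
  inflate (id_perm 3) [tuple a; b; c] =
  oneline a ++ [seq x + len a | x <- oneline b] ++
  [seq x + (len a + len b) | x <- oneline c].
Proof.
rewrite inflate3 /id_perm !perm1 /= !mul1n !mul0n !addn0.
by under eq_map do rewrite addn0; rewrite map_id.
Qed.

Lemma inflate_rev3 (a b c : perms) :
  inflate (rev_perm 3) [tuple a; b; c] =
  [seq x + (len b + len c) | x <- oneline a] ++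
  [seq x + len c | x <- oneline b] ++ oneline c.
Proof.
rewrite inflate3 /rev_perm !permE /= !mul1n !mul0n !add0n.
congr (_ ++ _ ++ _); rewrite -[RHS]map_id; apply: eq_map => x; exact: addn0.
Qed.

Lemma sum_word_embeds e A (t s : 'S_A) k :
  embeds (sum_word e t s k.+1) (sum_word e t s k.+2).
Proof.
rewrite -!inflate_block_peg; apply: inflate_embeds => i.
by rewrite !tnth_mktuple; case: ifP => _; [exact: monotoneS | exact: embeds_refl].
Qed.

(** * Unlabeled pegs *)

(** Its grid class contains p, and only permutations contained in p, so a short avoider is covered
    without leaving the class. *)
Definition plain_peg (p : perms) : peg :=
  existT _ (tag p) (tagged p, [ffun=> None]).

Lemma grid_plain_peg p : grid (plain_peg p) p.
Proof.
exists [tuple increasing 1 | i < tag p] => [i|].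
  by rewrite tnth_mktuple /peg_label ffunE.
by rewrite /is_inflation inflate_singles => [|i]; [case: p | rewrite tnth_mktuple].
Qed.

Lemma grid_plain_peg_embeds p q :
  grid (plain_peg p) q -> embeds (oneline q) (oneline p).
Proof.
move=> [alpha fl]; rewrite /is_inflation => ->.
have -> : oneline p = inflate (peg_perm (plain_peg p)) [tuple increasing 1 | i < tag p].
  by rewrite inflate_singles => [|i]; [case: p {alpha fl} | rewrite tnth_mktuple].
apply: inflate_embeds => i; rewrite tnth_mktuple; apply: len_le1.
by have := fl i; rewrite /peg_label ffunE.
Qed.

(** * From the shape to a finite set of pegs *)

Lemma rev_sum_word A (t s : 'S_A) k :
  rev (sum_word true t s k) =
  sum_word false (rev_perm A * t)%g (rev_perm A * s)%g k.
Proof.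
rewrite /sum_word !rev_cat catA !oneline_rev !map_rev /=.
by rewrite oneline_increasing oneline_decreasing map_rev.
Qed.

Lemma sum_word_of_fixed n (p : 'S_n) A k : n = A + k + A ->
  (forall x, [/\ A <= x < n - A -> pn p x = x, x < A -> pn p x < A
    & n - A <= x -> n - A <= pn p x]) ->
  exists t s : 'S_A, oneline (to_perms p) = sum_word true t s k.
Proof.
move=> en h.
(* [t] is the restriction to the first A positions; [s] below is the restriction to the last A,
   lowered by A + k. *)
have [||t ht] := @perm_of_fun A (pn p).
- by move=> x; case: (h x).
- by move=> x y _ _; apply: pn_inj.
have big x : x < A -> A + k <= pn p (A + k + x) < n.
  by move=> lt; rewrite pn_lt; case: (h (A + k + x)) => _ _; lia.
have [||s hs] := @perm_of_fun A (fun x => pn p (A + k + x) - (A + k)).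
- by move=> x /big; lia.
- move=> x y /big hx /big hy e.
  have /pn_inj : pn p (A + k + x) = pn p (A + k + y) by lia.
  by move/addnI.
have mapi (f : nat -> nat) m l :
    [seq f x | x <- iota m l] = [seq f (m + x) | x <- iota 0 l].
  by rewrite -{1}[m]addn0 iotaDl -map_comp.
exists t, s; rewrite /sum_word /= oneline_increasing !oneline_pn.
have -> : iota 0 n = iota 0 A ++ iota A k ++ iota (A + k) A by rewrite en !iotaD -catA.
rewrite !map_cat -map_comp (mapi _ A) (mapi _ 1) (mapi _ (A + k)).
congr (_ ++ _ ++ _); apply/eq_in_map => x; rewrite mem_iota /= add0n => lt.
- by rewrite ht.
- by have [hm _ _] := h (A + x); rewrite hm; lia.
- by rewrite hs //; have := big x lt; lia.
Qed.

(** Each [Q f] either holds everywhere or fails from some point on, beyond which the claim is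
    vacuous; finiteness of F gives a common bound. *)
Lemma antitone_dichotomy (F : finType) (Q : F -> nat -> Prop) :
  (forall f k, Q f k.+1 -> Q f k) ->
  exists K, forall f k, K <= k -> Q f k -> forall j, Q f j.
Proof.
move=> anti.
have le f i j : i <= j -> Q f j -> Q f i.
  by move=> /subnKC <-; elim: (j - i) => [|d IH]; rewrite ?addn0 // addnS => /anti.
have ex f : exists K, forall k, K <= k -> Q f k -> forall j, Q f j.
  case: (pselect (forall j, Q f j)) => [h|/existsNP[K nK]]; first by exists 0.
  by exists K => k /le leK /leK.
have [g hg] := choice ex.
exists (\max_f g f) => f k leK; apply: hg; apply: leq_trans leK.
exact: leq_bigmax.
Qed.

Lemma avoiders_nP T n (p : 'S_n) :
  reflect (avoids T (oneline (to_perms p))) (p \in avoiders_n T n).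
Proof. by rewrite inE; exact: asboolP. Qed.

Lemma avoiders_small (T : set perms) (gT : finGroupType) (G : {group gT}) n0 :
  (forall n, n0 <= n -> <<avoiders_n T n>>%g \isog G) ->
  small_class #|G| n0 (avoiders_n T).
Proof.
move=> hG; split.
- move=> n p i /avoiders_nP h; apply/avoiders_nP.
  exact: avoids_embeds (del_embeds p i) h.
- move=> n le; rewrite -(card_isog (hG n le)); exact/subset_leq_card/subset_gen.
- move=> n p q le hp hq; rewrite -(card_isog (hG n le)).
  apply: subset_leq_card; rewrite cycle_subG groupM ?groupV //; exact: mem_gen.
Qed.

(** The middle length is written as a successor because the inflation of [block_peg] is computed for
    a nonempty middle block. *)
Lemma avoiders_sum_word T M n0 n (p : 'S_n) : small_class M n0 (avoiders_n T) ->
  n0 + M + 2 * ends M + M.+2 <= n -> p \in avoiders_n T n ->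
  exists e (t s : 'S_(ends M)),
    oneline (to_perms p) = sum_word e t s (n - 2 * ends M).-1.+1.
Proof.
case: n p => [|n] p HD le hp; first lia.
have [||q [+ hq]] := @fixed_or_reversed_middle _ _ _ _ _ HD _ _ hp; [lia|lia|].
have en : n.+1 = ends M + (n.+1 - 2 * ends M).-1.+1 + ends M by lia.
have [t [s ets]] := sum_word_of_fixed en hq.
case=> eq; first by exists true, t, s; rewrite -eq.
exists false, (rev_perm _ * t)%g, (rev_perm _ * s)%g.
by rewrite -rev_sum_word -ets eq oneline_rev revK.
Qed.

Theorem theorem5p3 (T : set perms) (gT : finGroupType) (G : {group gT})
    (hG : exists n0 : nat, forall n : nat, n0 <= n ->
            <<avoiders_n T n>>%g \isog G) :
  exists P : seq peg,
    [/\ forall r : peg, r \in P ->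
          [\/ unlabeled r,
              exists a b : seq nat, plus_form r a b
            | exists a b : seq nat, minus_form r a b],
        avoiders T = grid_class P
      & exists N : nat, forall (n : nat) (p : 'S_n),
          N <= n -> p \in avoiders_n T n ->
          (exists (r : peg) (a b : seq nat) (t s : perms) (k : nat),
             [/\ r \in P /\ plus_form r a b,
                 contained t a, contained s b,
                 len t + len (increasing k) + len s = n
               & is_inflation (to_perms p) (id_perm 3)
                   [tuple t; increasing k; s]])
          \/
          (exists (r : peg) (a b : seq nat) (t s : perms) (k : nat),
             [/\ r \in P /\ minus_form r a b,
                 contained t a, contained s b,
                 len t + len (decreasing k) + len s = n
               & is_inflation (to_perms p) (rev_perm 3)
                   [tuple s; decreasing k; t]])].
Proof.
have [n0 /avoiders_small HD] := hG.
move: #|G| HD => M HD; set A := ends M.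
pose good (f : bool * 'S_A * 'S_A) k := avoids T (sum_word f.1.1 f.1.2 f.2 k.+1).
have [K hK] : exists K, forall f k, K <= k -> good f k -> forall j, good f j.
  by apply: antitone_dichotomy => f k; apply/avoids_embeds/sum_word_embeds.
(* All but the last summand make [avoiders_sum_word] apply; K makes the middle block long enough for
   [hK]. *)
pose N := n0 + M + 2 * A + M.+2 + K.
(* Only the pairs whose words avoid T for every middle length give a peg, so the grid class stays
   inside S(T). Permutations shorter than N are listed one by one in [small]. *)
pose blocks := [seq block_peg f.1.1 f.1.2 f.2 |
  f <- enum {: bool * 'S_A * 'S_A} & `[< forall k, good f k >]].
pose small := flatten [seq [seq plain_peg (to_perms p) | p <- enum (avoiders_n T n)] |
  n <- iota 0 N].
have blocksP r : r \in blocks ->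
    exists e t s, r = block_peg e t s /\ forall k, good (e, t, s) k.
  case/mapP=> [[[e t] s]]; rewrite mem_filter => /andP[/asboolP h _] ->.
  by exists e, t, s.
have smallP r : r \in small -> exists2 p, avoiders T p & r = plain_peg p.
  case/flatten_mapP=> n _ /mapP[p]; rewrite mem_enum => /avoiders_nP hp ->.
  by exists (to_perms p).
have large n (p : 'S_n) : N <= n -> p \in avoiders_n T n ->
    exists e (t s : 'S_A), [/\ block_peg e t s \in blocks &
      oneline (to_perms p) = sum_word e t s (n - 2 * A).-1.+1].
  move=> le hp; have [|e [t [s ep]]] := avoiders_sum_word HD _ hp.
    by rewrite -/A; move: le; rewrite /N; lia.
  exists e, t, s; split => //; apply/mapP; exists (e, t, s) => //.
  rewrite mem_filter mem_enum andbT; apply/asboolP.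
  (* The middle block of p itself is an admissible length beyond K, so all lengths are
     admissible. *)
  apply: (hK _ (n - 2 * A).-1); first by move: le; rewrite /N; lia.
  by rewrite /good /= -ep; exact/avoiders_nP.
exists (blocks ++ small); split.
- move=> r; rewrite mem_cat => /orP[/blocksP[[] [t [s [-> _]]]]|/smallP[p _ ->]].
  + by apply: Or32; do 2 eexists; exact: block_peg_plus.
  + by apply: Or33; do 2 eexists; exact: block_peg_minus.
  + by apply: Or31 => i; rewrite /peg_label ffunE.
- apply/seteqP; split=> [[n p] hp | p [r /=]].
    have hp' : p \in avoiders_n T n by exact/avoiders_nP.
    case: (ltnP n N) => [lt|le].
      exists (plain_peg (to_perms p)); last exact: grid_plain_peg.
      rewrite /= mem_cat; apply/orP; right; apply/flatten_mapP; exists n.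
        by rewrite mem_iota.
      by apply/map_f; rewrite mem_enum.
    have [e [t [s [hb ep]]]] := large n p le hp'.
    exists (block_peg e t s); first by rewrite /= mem_cat hb.
    exists (block_filling e A (n - 2 * A).-1.+1) => [i|].
      by rewrite tnth_mktuple /peg_label ffunE; case: ifP => _ //; case: (e); eexists.
    by rewrite /is_inflation inflate_block_peg.
  rewrite mem_cat => /orP[/blocksP[e [t [s [-> h]]]]|/smallP[q hq ->]].
    exact: grid_block_peg.
  by move/grid_plain_peg_embeds => h; exact: (avoids_embeds h).
exists N => n p le hp; have [e [t [s [hb ep]]]] := large n p le hp.
have hk : A + (n - 2 * A).-1.+1 + A = n by move: le; rewrite /N; lia.
case: e hb ep => hb ep; [left|right].
  (* The words a and b are left to be read off from [block_peg_plus]: the one-line notation of [t],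
     and that of [s] shifted by A + 1. *)
  exists (block_peg true t s); do 2 eexists.
  exists (to_perms t), (to_perms s), (n - 2 * A).-1.+1; split.
  - by split; [rewrite mem_cat hb | exact: block_peg_plus].
  - exact: embeds_refl.
  - exact: contained_shift.
  - exact: hk.
  - by rewrite /is_inflation inflate_id3.
exists (block_peg false t s); do 2 eexists.
exists (to_perms t), (to_perms s), (n - 2 * A).-1.+1; split.
- by split; [rewrite mem_cat hb | exact: block_peg_minus].
- exact: embeds_refl.
- exact: contained_shift.
- exact: hk.
- by rewrite /is_inflation inflate_rev3 ep /sum_word addnC.
Qed.
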